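(* Let $p$ be a prime or $p=\infty$, and let $x\in[0,1]$. Then there exists a function $\psi:\mathbb{N}\to\mathbb{R}_{\ge 0}$ such that $\mu_p(\mathfrak{A}^p(\psi))=\mu_p(\mathfrak{K}^p(\psi))=x$.
   Context: $\mathbb{N}=\{1,2,\dots\}$. For $p$ prime, $|\cdot|_p$ is the $p$-adic absolute value and $\mu_p$ is the Haar measure on $\mathbb{Q}_p$ with $\mu_p(\mathbb{Z}_p)=1$. For $p=\infty$, by convention $\mathbb{Z}_\infty=[0,1]$, $\mathbb{Q}_\infty=\mathbb{R}$, $|\cdot|_\infty=|\cdot|$ is the usual absolute value, and $\mu_\infty$ is the Lebesgue measure. For $\psi:\mathbb{N}\to\mathbb{R}_{\ge 0}$ consider the inequality $$\left|\alpha-\frac{a}{b}\right|_p\le\frac{\psi(|ab|)}{|ab|}. \qquad ( * )$$ $\mathfrak{A}^p(\psi)$ is the set of $\alpha\in\mathbb{Z}_p$ such that $( * )$ holds for infinitely many nonzero rational numbers $a/b$, written as reduced fractions ($a\in\mathbb{Z}\setminus\{0\}$, $b\in\mathbb{N}$, $\gcd(a,b)=1$). $\mathfrak{K}^p(\psi)$ is the set of $\alpha\in\mathbb{Z}_p$ such that $( * )$ holds for infinitely many pairs $(a,b)\in(\mathbb{Z}\setminus\{0\})\times\mathbb{N}$ (not necessarily coprime). *)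

(* Defs.v *)
From HB Require Import structures.
From mathcomp Require Import all_boot all_order all_algebra.
From mathcomp Require Import generic_quotient ring_quotient zify ring.
From mathcomp Require Import all_classical all_reals all_analysis.

Set Implicit Arguments.
Unset Strict Implicit.
Unset Printing Implicit Defensive.

Import Order.TTheory GRing.Theory Num.Theory.
Import numFieldNormedType.Exports.

Local Open Scope classical_set_scope.
Local Open Scope ring_scope.
Local Open Scope quotient_scope.

(* Q_p is built as the field of Cauchy sequences of rationals for |.|_p modulo
   null sequences; |.|_p takes rational values on Q_p, so that it makes Q_p a
   metric space over rat. *)

Section RatNorm.
Variable p : nat.

Definition rat_padic_norm (x : rat) : rat :=
  if x == 0 then 0
  else p%:R ^ ((logn p `|denq x|)%:Z - (logn p `|numq x|)%:Z).

Definition rat_padic_cauchy (u : nat -> rat) : Prop :=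
  forall e : rat, 0 < e -> exists N : nat, forall m n : nat,
    (N <= m)%N -> (N <= n)%N -> rat_padic_norm (u m - u n) < e.

Definition rat_padic_null (u : nat -> rat) : Prop :=
  forall e : rat, 0 < e -> exists N : nat, forall n : nat,
    (N <= n)%N -> rat_padic_norm (u n) < e.

End RatNorm.

Section RatNormTheory.
Variables (p : nat) (p_pr : prime p).
Local Notation nrm := (rat_padic_norm p).

Let p_gt0 : 0 < p%:R :> rat.
Proof. by rewrite ltr0n prime_gt0. Qed.

Let p_gt1 : 1 < p%:R :> rat.
Proof. by rewrite ltr1n prime_gt1. Qed.

Lemma rat_padic_norm0 : nrm 0 = 0.
Proof. by rewrite /rat_padic_norm eqxx. Qed.

Lemma rat_padic_normE (a b : int) : a != 0 -> b != 0 ->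
  nrm (a%:~R / b%:~R) = p%:R ^ ((logn p `|b|)%:Z - (logn p `|a|)%:Z).
Proof.
move=> a0 b0; rewrite /rat_padic_norm.
have x0 : a%:~R / b%:~R != 0 :> rat by rewrite mulf_neq0 ?invr_eq0 ?intr_eq0.
rewrite (negbTE x0); set x := _ / _ in x0 *.
have E : numq x * b = a * denq x.
  apply/eqP; rewrite -(eqr_int rat) !intrM.
  by rewrite numqE mulrAC [X in X * _]divfK ?intr_eq0.
have {E} : logn p `|numq x * b| = logn p `|a * denq x| by rewrite E.
rewrite !abszM !lognM ?absz_gt0 ?numq_eq0 ?denq_neq0 // => E.
by congr (_ ^ _); lia.
Qed.

Lemma rat_padic_norm_gt0 x : (0 < nrm x) = (x != 0).
Proof.
rewrite /rat_padic_norm; case: eqVneq => [_|_]; first by rewrite ltxx.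
by rewrite exprz_gt0.
Qed.

Lemma rat_padic_norm_ge0 x : 0 <= nrm x.
Proof.
have [->|x0] := eqVneq x 0; first by rewrite rat_padic_norm0.
by rewrite ltW // rat_padic_norm_gt0.
Qed.

Lemma rat_padic_norm_eq0 x : (nrm x == 0) = (x == 0).
Proof.
by apply: negb_inj; rewrite -[in RHS]rat_padic_norm_gt0 lt_def rat_padic_norm_ge0 andbT.
Qed.

Lemma rat_padic_normM x y : nrm (x * y) = nrm x * nrm y.
Proof.
have [->|x0] := eqVneq x 0; first by rewrite mul0r rat_padic_norm0 mul0r.
have [->|y0] := eqVneq y 0; first by rewrite mulr0 rat_padic_norm0 mulr0.
rewrite -[in LHS](divq_num_den x) -[in LHS](divq_num_den y) mulf_div -!intrM.
rewrite rat_padic_normE ?mulf_neq0 ?numq_eq0 ?denq_neq0 //.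
rewrite /rat_padic_norm (negbTE x0) (negbTE y0) -expfzDr ?gt_eqF //.
rewrite !abszM !lognM ?absz_gt0 ?numq_eq0 ?denq_neq0 //.
by rewrite !PoszD opprD addrACA.
Qed.

Lemma rat_padic_norm1 : nrm 1 = 1.
Proof.
by have := @rat_padic_normE 1 1 isT isT; rewrite divr1 => ->; rewrite logn1.
Qed.

Lemma rat_padic_normN x : nrm (- x) = nrm x.
Proof.
have := @rat_padic_normE (-1) 1 isT isT; rewrite divr1 /= logn1 => n1.
by rewrite -mulN1r rat_padic_normM -[-1]/((-1)%:~R) n1 mul1r.
Qed.

Lemma rat_padic_normV x : nrm x^-1 = (nrm x)^-1.
Proof.
have [->|x0] := eqVneq x 0; first by rewrite invr0 rat_padic_norm0.
apply: (@mulfI _ (nrm x)); first by rewrite rat_padic_norm_eq0.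
by rewrite -rat_padic_normM !divff ?rat_padic_norm_eq0 // rat_padic_norm1.
Qed.

Lemma rat_padic_normD x y : nrm (x + y) <= Num.max (nrm x) (nrm y).
Proof.
have [->|x0] := eqVneq x 0; first by rewrite add0r le_max lexx orbT.
have [->|y0] := eqVneq y 0; first by rewrite addr0 le_max lexx.
have [->|xy0] := eqVneq (x + y) 0.
  by rewrite rat_padic_norm0 le_max rat_padic_norm_ge0.
pose a := numq x * denq y; pose b := numq y * denq x; pose d := denq x * denq y.
have d0 : d != 0 by rewrite mulf_neq0 ?denq_neq0.
have a0 : a != 0 by rewrite mulf_neq0 ?denq_neq0 ?numq_eq0.
have b0 : b != 0 by rewrite mulf_neq0 ?denq_neq0 ?numq_eq0.
have xE : x = a%:~R / d%:~R.
  rewrite -[LHS]divq_num_den /a /d !intrM -mulf_div divff ?mulr1 //.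
  by rewrite intr_eq0 denq_neq0.
have yE : y = b%:~R / d%:~R.
  rewrite -[LHS]divq_num_den /b /d [denq x * _]mulrC !intrM -mulf_div.
  by rewrite divff ?mulr1 // intr_eq0 denq_neq0.
have xyE : x + y = (a + b)%:~R / d%:~R by rewrite xE yE -mulrDl -intrD.
have ab0 : a + b != 0.
  by apply: contra_neq xy0 => ab; rewrite xyE ab mul0r.
rewrite xyE xE yE !rat_padic_normE // le_max !ler_eXz2l // !lerD2l !lerN2.
rewrite !lez_nat -geq_min.
rewrite -pfactor_dvdn ?absz_gt0 //.
set k := minn _ _.
have ka : ((p ^ k)%:Z %| a)%Z.
  by rewrite dvdzE /= pfactor_dvdn ?absz_gt0 // geq_minl.
have kb : ((p ^ k)%:Z %| b)%Z.
  by rewrite dvdzE /= pfactor_dvdn ?absz_gt0 // geq_minr.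
suff: ((p ^ k)%:Z %| a + b)%Z by rewrite dvdzE.
exact: rpredD.
Qed.

Lemma rat_padic_normB x y : nrm (x - y) <= Num.max (nrm x) (nrm y).
Proof. by rewrite -(rat_padic_normN y) rat_padic_normD. Qed.

Lemma rat_padic_norm_dist x y : nrm (x - y) = nrm (y - x).
Proof. by rewrite -rat_padic_normN opprB. Qed.

Lemma rat_padic_norm_near x y : nrm (x - y) < nrm y -> nrm x = nrm y.
Proof.
move=> xy; have yx := rat_padic_normD (x - y) y.
rewrite subrK (max_r (ltW xy)) in yx.
apply/eqP; rewrite eq_le yx /= leNgt; apply/negP => ltxy.
have := rat_padic_normB x (x - y); rewrite opprB addrC subrK le_max.
by rewrite !leNgt ltxy xy.
Qed.

Lemma rat_padic_cauchy_bounded u : rat_padic_cauchy p u ->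
  exists C : rat, 0 < C /\ exists N : nat, forall n, (N <= n)%N -> nrm (u n) < C.
Proof.
move=> /(_ 1 ltr01)[N uN]; exists (Num.max 1 (nrm (u N)) + 1); split.
  by rewrite ltr_wpDl // le_max ler01.
exists N => n Nn; rewrite -[u n](subrK (u N)).
rewrite (le_lt_trans (rat_padic_normD _ _)) // gt_max.
apply/andP; split; last by rewrite ltr_pwDr // le_max lexx orbT.
by rewrite (lt_le_trans (uN _ _ Nn (leqnn N))) // lerDr le_max ler01.
Qed.

Lemma rat_padic_cauchyB u v :
  rat_padic_cauchy p u -> rat_padic_cauchy p v -> rat_padic_cauchy p (u - v).
Proof.
move=> cu cv e e0; have [M uM] := cu e e0; have [N vN] := cv e e0.
exists (maxn M N) => m n; rewrite !geq_max => /andP[Mm Nm] /andP[Mn Nn].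
rewrite [X in nrm X](_ : _ = (u m - u n) - (v m - v n)); last first.
  by rewrite -[(u - v) m]/(u m - v m) -[(u - v) n]/(u n - v n); ring.
by rewrite (le_lt_trans (rat_padic_normB _ _)) // gt_max uM ?vN.
Qed.

Lemma rat_padic_cauchyM u v :
  rat_padic_cauchy p u -> rat_padic_cauchy p v -> rat_padic_cauchy p (u * v).
Proof.
move=> cu cv e e0.
have [C [C0 [K uC]]] := rat_padic_cauchy_bounded cu.
have [D [D0 [L vD]]] := rat_padic_cauchy_bounded cv.
have [M uM] := cu (e / D) (divr_gt0 e0 D0).
have [N vN] := cv (e / C) (divr_gt0 e0 C0).
exists (maxn (maxn K L) (maxn M N)) => m n; rewrite !geq_max.
move=> /andP[/andP[Km Lm] /andP[Mm Nm]] /andP[/andP[Kn Ln] /andP[Mn Nn]].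
rewrite [X in nrm X](_ : _ = u m * (v m - v n) + (u m - u n) * v n); last first.
  by rewrite -[(u * v) m]/(u m * v m) -[(u * v) n]/(u n * v n); ring.
rewrite (le_lt_trans (rat_padic_normD _ _)) // gt_max !rat_padic_normM.
rewrite -[X in _ < X](divfK (lt0r_neq0 C0)) mulrC.
rewrite ltr_pM ?rat_padic_norm_ge0 ?vN ?uC //=.
rewrite -[X in _ < X](divfK (lt0r_neq0 D0)).
by rewrite ltr_pM ?rat_padic_norm_ge0 ?uM ?vD.
Qed.

Lemma rat_padic_cauchy1 : rat_padic_cauchy p (1 : nat -> rat).
Proof. by move=> e e0; exists 0 => m n _ _; rewrite subrr rat_padic_norm0. Qed.

Lemma rat_padic_null0 : rat_padic_null p (0 : nat -> rat).
Proof. by move=> e e0; exists 0 => n _; rewrite rat_padic_norm0. Qed.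

Lemma rat_padic_nullB u v :
  rat_padic_null p u -> rat_padic_null p v -> rat_padic_null p (u - v).
Proof.
move=> nu nv e e0; have [M uM] := nu e e0; have [N vN] := nv e e0.
exists (maxn M N) => n; rewrite geq_max => /andP[Mn Nn].
by rewrite (le_lt_trans (rat_padic_normB _ _)) // gt_max uM ?vN.
Qed.

Lemma rat_padic_nullM u v :
  rat_padic_cauchy p u -> rat_padic_null p v -> rat_padic_null p (u * v).
Proof.
move=> /rat_padic_cauchy_bounded[C [C0 [M uC]]] nv e e0.
have [N vN] := nv (e / C) (divr_gt0 e0 C0).
exists (maxn M N) => n; rewrite geq_max => /andP[Mn Nn].
rewrite rat_padic_normM -[X in _ < X](divfK (lt0r_neq0 C0)) mulrC.
by rewrite ltr_pM ?rat_padic_norm_ge0 ?vN ?uC.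
Qed.

Lemma rat_padic_null1 : ~ rat_padic_null p (1 : nat -> rat).
Proof. by move=> /(_ 1 ltr01)[N /(_ N (leqnn N))]; rewrite rat_padic_norm1 ltxx. Qed.

Lemma rat_padic_norm_stationary u : rat_padic_cauchy p u ->
  ~ rat_padic_null p u ->
  exists c : rat, 0 < c /\ exists N : nat, forall n, (N <= n)%N -> nrm (u n) = c.
Proof.
move=> cu /existsNP[e /not_implyP[e0 /forallNP nu]].
have [N uN] := cu e e0.
have [n0 /not_implyP[Nn0 /negP]] := (existsNP _).2 (nu N).
rewrite -leNgt => en0; exists (nrm (u n0)); split; first exact: lt_le_trans en0.
exists N => n Nn; apply: rat_padic_norm_near.
exact: lt_le_trans (uN _ _ Nn Nn0) en0.
Qed.

Lemma rat_padic_cauchyV u : rat_padic_cauchy p u -> ~ rat_padic_null p u ->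
  rat_padic_cauchy p (fun n => (u n)^-1).
Proof.
move=> cu /(rat_padic_norm_stationary cu)[c [c0 [M uM]]] e e0.
have [N uN] := cu (e * c ^+ 2) (mulr_gt0 e0 (exprn_gt0 2 c0)).
exists (maxn M N) => m n; rewrite !geq_max => /andP[Mm Nm] /andP[Mn Nn].
have um0 : u m != 0 by rewrite -rat_padic_norm_eq0 uM ?gt_eqF.
have un0 : u n != 0 by rewrite -rat_padic_norm_eq0 uM ?gt_eqF.
have -> : (u m)^-1 - (u n)^-1 = (u n - u m) * (u m * u n)^-1 by field; rewrite un0 um0.
rewrite rat_padic_normM rat_padic_normV rat_padic_normM !uM // -expr2.
by rewrite ltr_pdivrMr ?exprn_gt0 // uN.
Qed.

End RatNormTheory.

(* The proof p_pr is an unused argument so that the closure instances below can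
   be inferred from the predicate. *)
Definition padic_cauchy_pred p (p_pr : prime p) : {pred nat -> rat} :=
  fun u => `[< rat_padic_cauchy p u >].

Section CauchySequences.
Variables (p : nat) (p_pr : prime p).

Fact padic_cauchy_subring : subring_closed (padic_cauchy_pred p_pr).
Proof.
split=> [|u v|u v]; rewrite !unfold_in /padic_cauchy_pred.
- by apply/asboolP; exact: rat_padic_cauchy1.
- by move=> /asboolP cu /asboolP cv; apply/asboolP; exact: rat_padic_cauchyB.
- by move=> /asboolP cu /asboolP cv; apply/asboolP; exact: rat_padic_cauchyM.
Qed.

HB.instance Definition _ := GRing.isSubringClosed.Build (nat -> rat)
  (padic_cauchy_pred p_pr) padic_cauchy_subring.

Record padic_cauchy_seq := PadicCauchySeq {
  padic_seq_val :> nat -> rat;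
  _ : padic_seq_val \in padic_cauchy_pred p_pr }.

HB.instance Definition _ := [isSub for padic_seq_val].
HB.instance Definition _ := [Choice of padic_cauchy_seq by <:].
HB.instance Definition _ :=
  [SubChoice_isSubComNzRing of padic_cauchy_seq by <:].

Definition padic_null_ideal : {pred padic_cauchy_seq} :=
  fun u => `[< rat_padic_null p u >].

Lemma padic_cauchy_seqP (u : padic_cauchy_seq) : rat_padic_cauchy p u.
Proof. by case: u => u cu; exact/asboolP. Qed.

Fact padic_null_idealr : idealr_closed padic_null_ideal.
Proof.
split=> [||a u v]; rewrite !unfold_in /padic_null_ideal.
- by apply/asboolP; exact: rat_padic_null0.
- by apply/negP => /asboolP; exact: rat_padic_null1.
- move=> /asboolP nu /asboolP nv; apply/asboolP.
  rewrite [X in rat_padic_null p X](_ : _ = val a * val u - (0 - val v)).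
    apply: rat_padic_nullB => //; first exact: rat_padic_nullM (padic_cauchy_seqP a) nu.
    by apply: rat_padic_nullB => //; exact: rat_padic_null0.
  by rewrite sub0r opprK.
Qed.

HB.instance Definition _ := isIdealr.Build padic_cauchy_seq padic_null_ideal
  padic_null_idealr.

Definition padic := {ideal_quot padic_null_ideal}.
HB.instance Definition _ := GRing.ComNzRing.on padic.
HB.instance Definition _ := EqQuotient.on padic.
HB.instance Definition _ := isPointed.Build padic 0.

Lemma padic_pi_eq0 (u : padic_cauchy_seq) :
  (\pi_padic u == 0) = (u \in padic_null_ideal).
Proof. by rewrite -[0](@pi_zeror _ _ _ _ _ padic) -Quotient.idealrBE subr0. Qed.

Definition padic_inv (x : padic) : padic :=
  if x == 0 then 0
  else \pi_padic (insubd (0 : padic_cauchy_seq) (fun n => (repr x n)^-1)).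

Fact padic_mulVf (x : padic) : x != 0 -> padic_inv x * x = 1.
Proof.
move=> x0; rewrite /padic_inv (negbTE x0).
have cx := padic_cauchy_seqP (repr x).
have nx : ~ rat_padic_null p (repr x).
  by move: x0; rewrite -[x in x == _]reprK padic_pi_eq0 => /asboolP.
set v := insubd _ _.
have vE n : v n = (repr x n)^-1.
  rewrite /v -[LHS]/(val (insubd _ _) n) insubdK //.
  by apply/asboolP; exact: rat_padic_cauchyV.
rewrite -[x in _ * x]reprK -rmorphM -(rmorph1 \pi_padic).
apply/eqP; rewrite -subr_eq0 -rmorphB padic_pi_eq0; apply/asboolP => e e0.
have [c [c0 [N uN]]] := rat_padic_norm_stationary p_pr cx nx.
exists N => n Nn.
rewrite -[X in rat_padic_norm p X]/(v n * repr x n - 1) vE.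
rewrite mulVf ?subrr ?rat_padic_norm0 //.
by rewrite -(rat_padic_norm_eq0 p_pr) uN ?gt_eqF.
Qed.

Fact padic_invr0 : padic_inv 0 = 0.
Proof. by rewrite /padic_inv eqxx. Qed.

HB.instance Definition _ :=
  GRing.ComNzRing_isField.Build padic padic_mulVf padic_invr0.

Definition padic_abs (x : padic) : rat :=
  lim ((fun n => rat_padic_norm p (repr x n) : rat^o) @ \oo).

Lemma rat_padic_norm_lip x y :
  `|rat_padic_norm p x - rat_padic_norm p y| <= rat_padic_norm p (x - y).
Proof.
have le z t : rat_padic_norm p z - rat_padic_norm p t <= rat_padic_norm p (z - t).
  rewrite lerBlDr -{1}[z](subrK t).
  rewrite (le_trans (rat_padic_normD p_pr _ _)) // ge_max.
  by rewrite lerDl lerDr !rat_padic_norm_ge0.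
by rewrite ler_norml lerNl opprB le andbT rat_padic_norm_dist.
Qed.

Lemma padic_abs_cvg (u : padic_cauchy_seq) :
  (fun n => rat_padic_norm p (u n) : rat^o) @ \oo -->
    (padic_abs (\pi_padic u) : rat^o).
Proof.
set v := repr (\pi_padic u).
have uv : rat_padic_null p (u - v).
  suff: u - v \in padic_null_ideal by move/asboolP.
  by rewrite Quotient.idealrBE reprK.
have cvgv : cvg ((fun n => rat_padic_norm p (v n) : rat^o) @ \oo).
  have cv := padic_cauchy_seqP v.
  have [nv|/(rat_padic_norm_stationary p_pr cv)[c [_ [N vN]]]] :=
      pselect (rat_padic_null p v).
    apply/cvg_ex; exists 0; apply/cvgr0Pnorm_lt => e /nv[N vN].
    exists N => // n /= Nn; rewrite ger0_norm ?rat_padic_norm_ge0 //.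
    exact: vN.
  by apply/cvg_ex; exists c; apply: cvg_near_cst; exists N => // n /= /vN.
have -> : padic_abs (\pi_padic u) =
    0 + lim ((fun n => rat_padic_norm p (v n) : rat^o) @ \oo) :> rat^o.
  by rewrite add0r.
rewrite [X in X @ _ --> _](_ : _ = (fun n => (rat_padic_norm p (u n) -
    rat_padic_norm p (v n)) + rat_padic_norm p (v n) : rat^o)); last first.
  by apply/funext => n; rewrite subrK.
apply: (@cvgD _ (rat^o)); last exact: cvgv.
apply/cvgr0Pnorm_lt => e /uv[N uvN]; exists N => // n /= Nn.
exact: le_lt_trans (rat_padic_norm_lip _ _) (uvN n Nn).
Qed.

Lemma padic_abs_unique (u : padic_cauchy_seq) (c : rat^o) :
  (fun n => rat_padic_norm p (u n) : rat^o) @ \oo --> c ->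
  padic_abs (\pi_padic u) = c.
Proof. by apply: cvg_unique; [exact: norm_hausdorff|exact: padic_abs_cvg]. Qed.

Lemma padic_abs_ge0 x : 0 <= padic_abs x.
Proof.
rewrite -[x]reprK; apply: (cvgr_to_ge (@padic_abs_cvg (repr x))).
by apply: nearW => n; exact: rat_padic_norm_ge0.
Qed.

Lemma padic_abs_eq0 x : (padic_abs x == 0) = (x == 0).
Proof.
rewrite -[x]reprK padic_pi_eq0; set u := repr x; apply/eqP/asboolP.
  move=> u0; apply: contrapT => nu.
  have [c [c0 [N uN]]] := rat_padic_norm_stationary p_pr (padic_cauchy_seqP u) nu.
  have := @padic_abs_unique u c; rewrite u0 => uc.
  suff c00 : 0 = c by move: c0; rewrite -c00 ltxx.
  by apply: uc; apply: cvg_near_cst; exists N => // n /= /uN.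
move=> nu; apply: padic_abs_unique; apply/cvgr0Pnorm_lt => e /nu[N uN].
exists N => // n /= Nn; rewrite ger0_norm ?rat_padic_norm_ge0 //; exact: uN.
Qed.

Lemma padic_absM x y : padic_abs (x * y) = padic_abs x * padic_abs y.
Proof.
rewrite -[x]reprK -[y]reprK -rmorphM; apply: padic_abs_unique.
rewrite [X in X @ _ --> _](_ : _ = (fun n => rat_padic_norm p (repr x n) *
    rat_padic_norm p (repr y n) : rat^o)); last first.
  by apply/funext => n; rewrite -rat_padic_normM.
by apply: (@cvgM rat); exact: padic_abs_cvg.
Qed.

Lemma padic_absN x : padic_abs (- x) = padic_abs x.
Proof.
rewrite -[x]reprK -rmorphN; apply: padic_abs_unique.
rewrite [X in X @ _ --> _](_ : _ =
    (fun n => rat_padic_norm p (repr x n) : rat^o)); last first.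
  by apply/funext => n; exact: rat_padic_normN.
exact: padic_abs_cvg.
Qed.

Lemma padic_absD x y : padic_abs (x + y) <= Num.max (padic_abs x) (padic_abs y).
Proof.
rewrite -[x]reprK -[y]reprK -rmorphD; set u := repr x; set v := repr y.
apply/ler_addgt0Pr => e e0; set c := _ + e.
have uc : \forall n \near \oo, rat_padic_norm p (u n) < c.
  by apply: (cvgr_lt _ (@padic_abs_cvg u)); rewrite ltr_pwDr // le_max lexx.
have vc : \forall n \near \oo, rat_padic_norm p (v n) < c.
  by apply: (cvgr_lt _ (@padic_abs_cvg v)); rewrite ltr_pwDr // le_max lexx orbT.
apply: (cvgr_to_le (@padic_abs_cvg (u + v))).
apply: filterS2 uc vc => n uc vc.
by rewrite (le_trans (rat_padic_normD p_pr _ _)) // ge_max !ltW.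
Qed.

Lemma padic_abs_ratr (q : rat) : padic_abs (ratr q) = rat_padic_norm p q.
Proof.
have nat_seq (k n : nat) : (k%:R : nat -> rat) n = k%:R.
  by elim: k => // k IH; rewrite !mulrS -IH.
have absn (k : nat) : padic_abs k%:R = rat_padic_norm p k%:R.
  rewrite -(rmorph_nat \pi_padic); apply: padic_abs_unique.
  apply: cvg_near_cst; apply: nearW => n.
  have -> // : (k%:R : padic_cauchy_seq) n = k%:R.
  by rewrite -[LHS]/(val (k%:R : padic_cauchy_seq) n) rmorph_nat nat_seq.
have absz (k : int) : padic_abs k%:~R = rat_padic_norm p k%:~R.
  case: (intP k) => [|m|m]; rewrite ?mulrNz ?padic_absN ?rat_padic_normN //;
  exact: absn.
have d0 : (denq q)%:~R != 0 :> padic.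
  rewrite -padic_abs_eq0 absz rat_padic_norm_eq0 // intr_eq0 denq_neq0 //.
rewrite /ratr; apply: (@mulIf _ (padic_abs (denq q)%:~R)).
  by rewrite padic_abs_eq0.
by rewrite -padic_absM divfK // !absz -rat_padic_normM // -numqE.
Qed.

Definition padic_dist (x y : padic) : rat := padic_abs (x - y).

Fact padic_dist_xx x : padic_dist x x = 0.
Proof. by apply/eqP; rewrite padic_abs_eq0 subrr. Qed.

Fact padic_dist_positivity x y : padic_dist x y = 0 -> x = y.
Proof. by move/eqP; rewrite padic_abs_eq0 subr_eq0 => /eqP. Qed.

Fact padic_dist_sym x y : padic_dist x y = padic_dist y x.
Proof. by rewrite /padic_dist -padic_absN opprB. Qed.

Fact padic_dist_triangle y x z :
  padic_dist x z <= padic_dist x y + padic_dist y z.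
Proof.
rewrite /padic_dist -[x - z](subrKA y) (le_trans (padic_absD _ _)) // ge_max.
by rewrite lerDl lerDr !padic_abs_ge0.
Qed.

HB.instance Definition _ := isMetric.Build rat padic padic_dist_xx
  padic_dist_positivity padic_dist_sym padic_dist_triangle.

Definition padic_integers : set padic := [set x | padic_abs x <= 1].

Definition padic_borel : measurableType _ := g_sigma_algebraType (@open padic).

End CauchySequences.

(* The Haar measure on Q_p normalized on Z_p; it is finite on compact sets
   because compact sets are covered by finitely many translates of Z_p. *)
Definition is_padic_haar (R : realType) (p : nat) (p_pr : prime p)
    (mu : {measure set (padic_borel p_pr) -> \bar R}) : Prop :=
  (forall (a : padic p_pr) (A : set (padic p_pr)),
     measurable (A : set (padic_borel p_pr)) ->
     mu [set a + x | x in A] = mu A) /\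
  mu (@padic_integers p p_pr) = 1%E.

Section Approximation.
Variables (R : realType) (K : fieldType) (absK : K -> R) (Z : set K).
Variable psi : nat -> R.

Definition psi_close (alpha : K) (a : int) (b : nat) : Prop :=
  absK (alpha - a%:~R / b%:R) <= psi (`|a| * b)%N / (`|a| * b)%:R.

Definition frakA : set K :=
  [set alpha | Z alpha /\
    infinite_set [set ab : int * nat | [/\ ab.1 != 0, (0 < ab.2)%N,
      coprime `|ab.1| ab.2 & psi_close alpha ab.1 ab.2]]].

Definition frakK : set K :=
  [set alpha | Z alpha /\
    infinite_set [set ab : int * nat | [/\ ab.1 != 0, (0 < ab.2)%N
      & psi_close alpha ab.1 ab.2]]].

End Approximation.

(* Main.v *)
Require Import Defs.
From mathcomp Require Import all_boot all_order all_algebra.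
From mathcomp Require Import generic_quotient cyclic zify ring lra.
From mathcomp Require Import all_classical all_reals all_analysis.

Import Order.TTheory GRing.Theory Num.Theory.
Import numFieldNormedType.Exports.
Local Open Scope classical_set_scope.
Local Open Scope ring_scope.

(** The values psi n / n need not be small: each n contributes balls of radius
    psi n / n around all fractions a / b with |a| b = n, and what has to be
    understood is which of these balls recur for infinitely many n.

    Over the reals, take n = a q with q prime and a < q. The positive fractions
    a' / b' with a' b' = n are then at most a / q or at least q / a. So if psi is
    carried by the n with a <= x q, with radius 1 / q, all the centres that
    matter lie below x. Every point of ]0, x[ is within 1 / q of some a / q for
    each large q ([real_lower]), while a point of ]x, 1] meets the balls for
    finitely many q only ([real_upper]). Where psi vanishes, only fractions
    satisfy the inequality, and they form a null set.

    Over the p-adic numbers, let l be a prime congruent to 1 modulo a high power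
    of p. Multiplying or dividing by l hardly moves a p-adic integer, so the
    fractions with |a| b = m l lie close to those with |a| b = m. There are
    infinitely many such l ([prime_eq1_mod]). Hence the set [padic_near m N],
    of the points at distance at most p^-N from a fraction with |a| b = m,
    recurs infinitely often once psi (m l) / (m l) = p^-N for these l, and any
    union of sets [padic_near m N] is, up to fractions, the approximation set of
    some psi ([padic_frakA_lower], [padic_frakK_upper]).

    It remains to find a union of measure x. If |a| b = m <= p^(2k), one of |a|
    and b is at most p^k, so [padic_near m (2k)] has measure at most 4 p^-k
    ([haar_padic_near]); but for each k these sets cover Z_p, since every p-adic
    integer is close to one of 1, ..., p^(2k). So the available sets can be
    taken arbitrarily small while still covering Z_p, and a greedy choice
    reaches measure exactly x ([measure_subfamily_eq]).

    Reduced and arbitrary fractions give the same set because a fraction with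
    |a| b = m and gcd g reduces to one with |a'| b' = m / g^2: adding all the
    pairs (m / g^2, N) to the chosen pairs (m, N) leaves the union unchanged and
    makes every one of its points approximable by reduced fractions. *)

(** * Measures *)

Section Measure.
Context {d : measure_display} {T : sigmaRingType d} {R : realType}.
Variable mu : {measure set T -> \bar R}.

Lemma negligible_countable (C : set T) :
  (forall y, mu.-negligible [set y]) -> countable C -> mu.-negligible C.
Proof.
move=> mu1 /countable_injP[f finj].
apply: (@negligibleS _ _ _ _ (\bigcup_k [set c | C c /\ f c = k])).
  by move=> c Cc; exists (f c).
apply: negligible_bigcup => k.
have [[c [Cc fck]]|nk] := pselect (exists c, C c /\ f c = k).
  apply: negligibleS (mu1 c) => e [Ce fek].
  by apply: finj; rewrite ?inE // fck.
apply: negligibleS (negligible_set0 mu) => e [Ce fek].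
by apply: nk; exists e.
Qed.

(** The approximation sets are known only up to countably many points; since
    A minus U is countable, A is measurable too. *)
Lemma measure_between_countable {U A C : set T} :
  measurable U -> U `<=` A -> A `<=` U `|` C ->
  (forall y : T, measurable [set y]) -> (forall y, mu [set y] = 0%E) ->
  countable C -> mu A = mu U.
Proof.
move=> mU UA AUC m1 mu1 cC.
have cAU : countable (A `\` U).
  by apply: sub_countable cC; apply: subset_card_le => y [/AUC[]].
have mAU := countable_measurable m1 cAU.
have -> : A = U `|` (A `\` U).
  by rewrite setDUK.
apply: measureU0 => //; apply/(negligibleP mu mAU).
apply: negligible_countable cAU => y.
by apply/(negligibleP mu (m1 y)); exact: mu1.
Qed.

(** Greedy choice: run through the B t and keep B t whenever the union stays of
    measure at most x. If the final union fell short of x by e > 0, then every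
    B t of measure at most e would have been kept, and these cover V. *)
Lemma measure_subfamily_eq (x : R) (V : set T) (B : nat -> set T) :
  0 <= x -> measurable V -> (x%:E <= mu V)%E ->
  (forall t, measurable (B t)) ->
  (forall e : R, 0 < e ->
     V `<=` \bigcup_(t in [set t | (mu (B t) <= e%:E)%E]) B t) ->
  exists S : set nat, mu (\bigcup_(t in S) B t) = x%:E.
Proof.
move=> x0 mV xV mB small.
pose step (G : set T) t := if (mu (G `|` B t) <= x%:E)%E then G `|` B t else G.
pose G := fix G n := if n is t.+1 then step (G t) t else set0.
pose S := [set t | (mu (G t `|` B t) <= x%:E)%E]; exists S.
have mG n : measurable (G n).
  elim: n => //= t IH; rewrite /step; case: ifP => // _; exact: measurableU.
have Gx n : (mu (G n) <= x%:E)%E.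
  elim: n => [|t IH] /=; first by rewrite measure0.
  by rewrite /step; case: ifP.
have GS t : G t `<=` G t.+1.
  by move=> y; rewrite /= /step; case: ifP => // _; left.
have Gmono : {homo G : n m / (n <= m)%N >-> (n <= m)%O}.
  apply: homo_leq => [A|B' A C|t]; [exact: lexx|exact: le_trans|].
  by rewrite subsetEset; exact: GS.
have -> : \bigcup_(t in S) B t = \bigcup_n G n.
  apply/seteqP; split=> y.
    by move=> [t St Bt]; exists t.+1 => //=; rewrite /step St; right.
  move=> [n _]; elim: n => //= t IH; rewrite /step; case: ifP => // St.
  by move=> [/IH//|Bt]; exists t.
have mU : measurable (\bigcup_n G n) by apply: bigcup_measurable.
have cG := @nondecreasing_cvg_mu _ _ _ mu _ mG mU Gmono.
have le1 : (mu (\bigcup_n G n) <= x%:E)%E.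
  rewrite -(cvg_lim _ cG) //; apply: lime_le.
    by apply/cvg_ex; exists (mu (\bigcup_n G n)).
  by apply: nearW => n; exact: Gx.
apply/eqP; rewrite eq_le le1 /= leNgt; apply/negP => lt1.
have fin : mu (\bigcup_n G n) \is a fin_num.
  by rewrite ge0_fin_numE // (le_lt_trans le1) // ltry.
set u := fine (mu (\bigcup_n G n)).
have uE : mu (\bigcup_n G n) = u%:E by rewrite fineK.
have e0 : 0 < x - u by rewrite subr_gt0 -lte_fin -uE.
suff VG : V `<=` \bigcup_n G n.
  have := le_lt_trans (le_measure mu (mem_set mV) (mem_set mU) VG) lt1.
  by rewrite ltNge xV.
move=> y /(small _ e0)[t /= Bte By]; exists t.+1 => //=; rewrite /step ifT.
  by right.
have mGt : measurable (G t) := mG t; have mBt := mB t.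
apply: (le_trans (measureU2 mu mGt mBt)).
have -> : x%:E = (u%:E + (x - u)%:E)%E by rewrite -EFinD addrC subrK.
apply: leeD => //; rewrite -uE; apply: le_measure; rewrite ?inE //.
exact: bigcup_sup.
Qed.

End Measure.

(** * Primes and pairs of integers *)

Section Arithmetic.
Local Open Scope nat_scope.

Lemma max_pdivM_prime (m q : nat) : prime q -> 0 < m < q ->
  max_pdiv (m * q) = q.
Proof.
move=> q_pr /andP[m0 mq]; have q1 := prime_gt1 q_pr.
have n1 : 1 < m * q by nia.
have := max_pdiv_dvd (m * q); rewrite Euclid_dvdM ?max_pdiv_prime //.
case/orP => [dm|]; last by rewrite dvdn_prime2 ?max_pdiv_prime // => /eqP.
have := max_pdiv_max (n := m * q) (p := q).
have -> : q \in \pi(m * q) by rewrite mem_primes q_pr dvdn_mull // muln_gt0 m0 prime_gt0.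
by move=> /(_ isT); have := dvdn_leq m0 dm; lia.
Qed.

(** With y = (max M p)!, let l be a prime factor of 1 + z + ... + z^(p-1) where
    z = y^(p^k); this sum is the p^(k+1)-th cyclotomic polynomial at y. Since l
    does not divide y, it exceeds M and p. The order of y modulo l divides
    p^(k+1); it does not divide p^k, for otherwise z = 1 and the sum would be p
    modulo l. So p^(k+1) divides l - 1. *)
Lemma prime_eq1_mod (p k M : nat) : prime p ->
  exists l, [/\ prime l, M < l & p ^ k %| l.-1].
Proof.
move=> p_pr; case: k => [|k].
  by have [l Ml l_pr] := prime_above M; exists l; rewrite l_pr Ml expn0 dvd1n.
pose z := (maxn M p)`! ^ (p ^ k).
have z1 : 0 < z by rewrite expn_gt0 fact_gt0.
have /pdivP[l l_pr l_dvd] : 1 < \sum_(i < p) z ^ i.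
  have := prime_gt1 p_pr; case: (p) => // -[//|q] _.
  by rewrite !big_ord_recl /= expn0 expn1; lia.
set y := (maxn M p)`! in z z1 l_dvd *.
have ly : ~~ (l %| y).
  apply/negP => ly; have lz : l %| z by rewrite dvdn_exp // expn_gt0 prime_gt0.
  move: l_dvd; have := prime_gt1 p_pr; case: (p) => // q _.
  rewrite big_ord_recl expn0 dvdn_addl; last first.
    by apply: dvdn_sum => i _; rewrite dvdn_exp.
  by have := prime_gt1 l_pr; rewrite dvdn1; lia.
have l_gt : maxn M p < l.
  by rewrite ltnNge; apply: contra ly => lM; rewrite dvdn_fact ?prime_gt0.
exists l; split => //; first by lia.
have exp1 e c : y ^ e = 1 %[mod l] -> y ^ (e * c) = 1 %[mod l].
  by move=> ye; rewrite expnM -modnXm ye modnXm exp1n.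
have yp : y ^ (p ^ k.+1) = 1 %[mod l].
  apply/eqP; rewrite expnSr expnM -/z eqn_mod_dvd; last by rewrite expn_gt0 z1.
  rewrite subn1 predn_exp.
  exact: dvdn_mull.
have yl : y ^ l.-1 = 1 %[mod l].
  rewrite -totient_prime //; apply: Euler_exp_totient.
  by rewrite coprime_sym prime_coprime.
(* The order of y divides gcd (p^(k+1), l - 1) = p^j. *)
have pk0 : 0 < p ^ k.+1 by rewrite expn_gt0 prime_gt0.
have [a _ /dvdnP[c bez]] := Bezoutl l.-1 pk0.
have [j jk gE] := dvdn_pfactor _ _ p_pr (dvdn_gcdl (p ^ k.+1) l.-1).
have [j_eq|j_neq] := eqVneq j k.+1; first by rewrite -j_eq -gE dvdn_gcdr.
have yg : y ^ (p ^ j) = 1 %[mod l].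
  have := exp1 _ c yp; rewrite mulnC -bez gE expnD.
  by rewrite -modnMmr [a * _]mulnC exp1 // modnMmr muln1.
have zl : z = 1 %[mod l].
  by rewrite /z -(subnKC (_ : j <= k)) ?expnD ?exp1 //; lia.
have : \sum_(i < p) z ^ i = p %[mod l].
  rewrite -[p in RHS]card_ord -sum1_card; elim/big_rec2: _ => // i u v _ uv.
  by rewrite -modnDm uv -modnXm zl modnXm exp1n modnDm.
rewrite (eqP l_dvd) => /esym/eqP; rewrite -/(l %| p) => /(dvdn_leq (prime_gt0 p_pr)).
by rewrite leqNgt (leq_ltn_trans (leq_maxr M p) l_gt).
Qed.
End Arithmetic.

Lemma infinite_pairs (S : set (int * nat)) :
  (forall M : nat, exists2 ab, S ab & (M < `|ab.1| * ab.2)%N) -> infinite_set S.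
Proof.
move=> unb /finite_seqP[X SX].
have [ab Sab] := unb (\max_(i <- X) (`|i.1| * i.2)%N).
by apply/negP; rewrite -leqNgt; apply: leq_bigmax_seq => //; move: Sab; rewrite SX.
Qed.

Lemma unbounded_pairs {S : set (int * nat)} (M : nat) :
  (forall ab, S ab -> ab.1 != 0 /\ (0 < ab.2)%N) ->
  infinite_set S -> exists2 ab, S ab & (M < `|ab.1| * ab.2)%N.
Proof.
move=> S0 infS; apply: contrapT => nM; apply: infS.
apply: (@sub_finite_set _ _
  (((fun n : nat => n%:Z) @` `I_M.+1 `|` (fun n : nat => - n%:Z) @` `I_M.+1)
   `*` `I_M.+1)).
  move=> [a b] Sab; have [/= a0 b0] := S0 _ Sab.
  have abM : (`|a| * b <= M)%N.
    by rewrite leqNgt; apply/negP => ?; apply: nM; exists (a, b).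
  have aM : (`|a| < M.+1)%N by nia.
  split; last by rewrite /=; nia.
  by case: (leP 0 a) => s; [left|right]; exists `|a|%N => //=; lia.
by apply: finite_setX => //; rewrite finite_setU; split; exact: finite_image.
Qed.

Lemma reduce_fraction (a : int) (b : nat) : a != 0 -> (0 < b)%N ->
  exists (g b' : nat) (a' : int), [/\ (0 < g)%N, a = a' * g%:Z, b = (b' * g)%N
    & coprime `|a'| b'].
Proof.
move=> a0 b0; pose g := gcdn `|a| b.
have g0 : (0 < g)%N by rewrite gcdn_gt0 b0 orbT.
have aE : a = (a %/ g%:Z)%Z * g%:Z by rewrite divzK // dvdzE /= dvdn_gcdl.
have bE : b = (b %/ g * g)%N by rewrite divnK // dvdn_gcdr.
exists g, (b %/ g)%N, (a %/ g%:Z)%Z; split => //.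
rewrite /coprime -(eqn_pmul2r g0) mul1n muln_gcdl -bE.
by rewrite -[X in (_ * X)%N]/(`|g%:Z|%N) -abszM -aE.
Qed.

(** The fractions satisfy the approximation inequality even where psi vanishes,
    whence an exceptional null set in both cases of the theorem. *)
Definition fractions (K : fieldType) : set K :=
  [set ab.1%:~R / ab.2%:R | ab in [set: int * nat]].

Lemma countable_fractions (K : fieldType) : countable (fractions K).
Proof. exact: sub_countable (card_image_le _ _) (countableP _). Qed.

Lemma frakA_sub_frakK (R : realType) (K : fieldType) (absK : K -> R) (Z : set K)
    (psi : nat -> R) :
  frakA absK Z psi `<=` frakK absK Z psi.
Proof.
move=> y [Zy inf]; split => // fin; apply: inf.
by apply: sub_finite_set fin => ab [].
Qed.

(** * The real case *)

Section Real.
Context {R : realType}.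

(** On n = a q with q the largest prime factor of n, the radius psi n / n is
    1 / q when a < q and a / q <= x, and 0 otherwise. *)
Definition real_psi (x : R) (n : nat) : R :=
  let q := max_pdiv n in let a := (n %/ q)%N in
  if (a < q)%N && (a%:R <= x * q%:R) then a%:R else 0.

Lemma real_psiE (x : R) (a q : nat) : prime q -> (0 < a < q)%N ->
  a%:R <= x * q%:R -> real_psi x (a * q) = a%:R.
Proof.
move=> q_pr aq ax; rewrite /real_psi max_pdivM_prime // mulnK ?prime_gt0 //.
by case/andP: aq => _ ->; rewrite ax.
Qed.

Lemma real_psi_neq0 (x : R) (n : nat) : (0 < n)%N -> real_psi x n != 0 ->
  exists a q : nat, [/\ prime q, (0 < a < q)%N, a%:R <= x * q%:R,
    n = (a * q)%N & real_psi x n = a%:R].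
Proof.
rewrite /real_psi; set q := max_pdiv n; set a := (n %/ q)%N => n0.
case: ifP => [/andP[aq ax]|_]; last by rewrite eqxx.
have nE : n = (a * q)%N by rewrite divnK ?max_pdiv_dvd.
move=> _; exists a, q; split => //.
  by apply: max_pdiv_prime; case: (n) n0 @q @a aq {ax nE} => [//|[|//]].
by rewrite aq andbT; move: n0; rewrite nE muln_gt0 => /andP[].
Qed.

(** For a large prime q, the integer part a of alpha q satisfies 0 < a < x q and
    |alpha - a / q| < 1 / q. *)
Lemma real_lower (x : R) : x <= 1 ->
  `]0, x[ `<=` frakA (fun y : R => `|y|) `[0, 1] (real_psi x).
Proof.
move=> x1 alpha /=; rewrite in_itv /= => /andP[a0 ax].
split; first by rewrite /= in_itv /= !ltW // (lt_le_trans ax).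
apply: infinite_pairs => M.
have [q Mq q_pr] := prime_above (maxn M (Num.truncn alpha^-1)).
have q0 : 0 < q%:R :> R by rewrite ltr0n prime_gt0.
have aq0 : 0 <= alpha * q%:R by rewrite mulr_ge0 ?ltW.
have aq1 : 1 <= alpha * q%:R.
  rewrite -ler_pdivrMl // mulr1 ltW //.
  apply: lt_le_trans (truncnS_gt _) _; rewrite ler_nat.
  by rewrite (leq_trans _ Mq) // ltnS leq_maxr.
set a := Num.truncn (alpha * q%:R).
have /andP[le_a lt_a] := truncn_itv aq0.
have a_gt0 : (0 < a)%N by rewrite truncn_gt0.
have a_lt : (a < q)%N.
  rewrite -(ltr_nat R) (le_lt_trans le_a) // gtr_pMl //.
  exact: lt_le_trans x1.
exists (a%:Z, q) => /=; last first.
  by apply: leq_ltn_trans (leq_maxl M _) (leq_trans Mq _); rewrite leq_pmull.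
split => //; first by rewrite eqz_nat -lt0n.
  by rewrite prime_gt0.
  by rewrite coprime_sym prime_coprime // gtnNdvd.
rewrite /psi_close /= real_psiE ?a_gt0 //; last first.
  by rewrite (le_trans le_a) // ler_pM2r // ltW.
have a0R : 0 < a%:R :> R by rewrite ltr0n.
have -> : alpha - a%:~R / q%:R = (alpha * q%:R - a%:R) / q%:R.
  by rewrite mulrBl mulfK ?gt_eqF.
rewrite natrM invfM mulrA divff ?gt_eqF // mul1r normrM normfV (gtr0_norm q0).
rewrite ger_pMl ?invr_gt0 // ger0_norm ?subr_ge0 //.
by rewrite lerBlDl natr1 ltW.
Qed.

(** If q divides the denominator, the fraction is at most c / q <= x in absolute
    value, where n = c q. If q divides the numerator, the fraction is negative or
    at least q / c >= 1 / x. In each case a point alpha > x of [0, 1] is not within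
    1 / q of it as soon as 1 / q < alpha - x, which holds when n is large. *)
Lemma real_upper (x : R) : 0 <= x <= 1 ->
  frakK (fun y : R => `|y|) `[0, 1] (real_psi x) `<=` `[0, x] `|` fractions R.
Proof.
move=> /andP[x0 x1] alpha [/=]; rewrite in_itv /= => /andP[a0 a1] inf.
have [rat_a|nrat] := pselect (fractions R alpha); first by right.
left; rewrite /= in_itv /= a0 leNgt; apply/negP => xa.
have ax0 : 0 < alpha - x by rewrite subr_gt0.
pose N := (Num.truncn (alpha - x)^-1).+1.
have [|[a b] [/= a_neq0 b_gt0 close] big] := unbounded_pairs (N * N)%N _ inf.
  by move=> [a b] [].
have n_gt0 : (0 < `|a| * b)%N by rewrite muln_gt0 absz_gt0 a_neq0.
move: close; rewrite /psi_close; have [->|] := eqVneq (real_psi x (`|a| * b)) 0.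
  rewrite mul0r normr_le0 subr_eq0 => /eqP aE; case: nrat.
  by exists (a, b).
case/(real_psi_neq0 _ _ n_gt0) => c [q [q_pr /andP[c0 cq] cx nE ->]].
rewrite nE.
(* n = c q > N^2 with c < q forces q > N > 1 / (alpha - x). *)
have c0R : 0 < c%:R :> R by rewrite ltr0n.
have b0R : 0 < b%:R :> R by rewrite ltr0n.
have q0 : 0 < q%:R :> R by rewrite ltr0n prime_gt0.
rewrite natrM invfM mulrA divff ?gt_eqF // mul1r => close.
have q_big : q%:R^-1 < alpha - x.
  have Nq : (N < q)%N.
    rewrite ltnNge; apply/negP => qN.
    by have := leq_mul (leq_trans (ltnW cq) qN) qN; rewrite leqNgt -nE big.
  rewrite invf_plt ?posrE // (lt_le_trans (truncnS_gt _)) // ler_nat.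
  exact: ltnW.
suff : alpha <= x + q%:R^-1 by rewrite leNgt -ltrBDl q_big.
have: (q %| `|a| * b)%N by rewrite nE dvdn_mull.
move: close; rewrite ler_norml => /andP[close1 close2].
rewrite Euclid_dvdM // => /orP[/dvdnP[e aE]|/dvdnP[e bE]].
  have ecb : (e * b = c)%N.
    by apply/eqP; rewrite -(eqn_pmul2r (prime_gt0 q_pr)) -nE aE mulnAC.
  have e0 : (0 < e)%N by move: c0; rewrite -ecb muln_gt0 => /andP[].
  move: (a_neq0); rewrite neq_lt => /orP[a_lt0|a_gt0].
    have : a%:~R / b%:R <= 0 :> R.
      by rewrite pmulr_lle0 ?invr_gt0 // lerz0 ltW.
    lra.
  have aR : a%:~R = (e * q)%:R :> R by rewrite -aE natr_absz gtr0_norm.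
  have le1 : q%:R / c%:R <= a%:~R / b%:R :> R.
    rewrite ler_pdivrMr // mulrAC ler_pdivlMr // aR -!natrM ler_nat.
    by rewrite -ecb leq_mul // leq_pmull.
  have le2 : 1 <= x * (q%:R / c%:R).
    by rewrite mulrA ler_pdivlMr // mul1r.
  have {}le2 : 1 <= x * (alpha + q%:R^-1).
    by apply: (le_trans le2); apply: ler_wpM2l => //; lra.
  have q1 : 0 < q%:R^-1 :> R by rewrite invr_gt0.
  by nra.
have ecb : (`|a| * e = c)%N.
  by apply/eqP; rewrite -(eqn_pmul2r (prime_gt0 q_pr)) -nE bE mulnA.
have e0 : (0 < e)%N by move: c0; rewrite -ecb muln_gt0 => /andP[].
have : a%:~R / b%:R <= x :> R.
  rewrite ler_pdivrMr //; apply: le_trans (ler_norm _) _.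
  rewrite -intr_norm -natr_absz.
  have : `|a|%:R <= c%:R :> R by rewrite ler_nat -ecb leq_pmulr.
  move=> /le_trans; apply; apply: (le_trans cx); apply: ler_wpM2l => //.
  by rewrite ler_nat bE leq_pmull.
by lra.
Qed.

Lemma real_case (x : R) : 0 <= x <= 1 ->
  exists psi : nat -> R, (forall n, (0 < n)%N -> 0 <= psi n) /\
      lebesgue_measure (frakA (fun y : R => `|y|) `[0, 1] psi) = x%:E /\
      lebesgue_measure (frakK (fun y : R => `|y|) `[0, 1] psi) = x%:E.
Proof.
move=> x01; have /andP[x0 x1] := x01; exists (real_psi x); split.
  by move=> n _; rewrite /real_psi; case: ifP.
have mI : lebesgue_measure (`]0, x[%classic : set R) = x%:E.
  rewrite lebesgue_measure_itv /= lte_fin; case: ltP => [_|x_le0].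
    by rewrite -EFinD subr0.
  by congr _%:E; lra.
have AK : frakA (fun y : R => `|y|) `[0, 1] (real_psi x) `<=`
          frakK (fun y : R => `|y|) `[0, 1] (real_psi x).
  exact: frakA_sub_frakK.
(* The exceptional points are the fractions (among them 0) and x. *)
pose f o := if o is Some ab then ab.1%:~R / ab.2%:R else x.
pose C : set R := [set f o | o in [set: option (int * nat)]].
have KI : frakK (fun y : R => `|y|) `[0, 1] (real_psi x) `<=` `]0, x[ `|` C.
  move=> alpha /(real_upper _ x01)[|[ab _ <-]]; last by right; exists (Some ab).
  rewrite /= !in_itv /= => /andP[].
  rewrite le_eqVlt => /orP[/eqP<- _|a0].
    by right; exists (Some (0, 1%N)); rewrite //= mul0r.
  rewrite le_eqVlt => /orP[/eqP-> |ax]; first by right; exists None.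
  by left; rewrite a0.
have cC : countable C.
  exact: sub_countable (card_image_le _ _) (countableP _).
have m1 (y : R) : measurable [set y] by exact: measurable_set1.
have m0 (y : R) : lebesgue_measure [set y] = 0%E by exact: lebesgue_measure_set1.
have mU : measurable (`]0, x[%classic : set R) by exact: measurable_itv.
have sub := real_lower _ x1.
split; rewrite -mI.
  exact: (measure_between_countable lebesgue_measure mU sub (subset_trans AK KI) m1 m0 cC).
exact: (measure_between_countable lebesgue_measure mU (subset_trans sub AK) KI m1 m0 cC).
Qed.
End Real.

(** * p-adic numbers *)

Local Open Scope quotient_scope.

Lemma exists_exprVn_lt (K : archiRealFieldType) (p : nat) (e : K) :
  (1 < p)%N -> 0 < e -> exists N : nat, p%:R ^- N < e.
Proof.
move=> p1 e0; exists (Num.truncn e^-1).+1.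
have p0 : 0 < p%:R :> K by rewrite ltr0n ltnW.
rewrite invf_plt ?posrE ?exprn_gt0 // (lt_trans (truncnS_gt _)) //.
by rewrite -natrX ltr_nat ltn_expl.
Qed.

Lemma rat_padic_norm_int_le (p N : nat) (k : int) : prime p ->
  (rat_padic_norm p k%:~R <= p%:R ^- N) = (p ^ N %| `|k|)%N.
Proof.
move=> p_pr; have p1 : 1 < p%:R :> rat by rewrite ltr1n prime_gt1.
have [->|k0] := eqVneq k 0.
  by rewrite rat_padic_norm0 dvdn0 invr_ge0 exprn_ge0 // ler0n.
have := @rat_padic_normE p p_pr k 1 k0 isT; rewrite divr1 => ->.
by rewrite logn1 sub0r exprnN ler_eXz2l // lerN2 lez_nat pfactor_dvdn ?absz_gt0.
Qed.

Section Padic.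
Context {p : nat} {p_pr : prime p}.
Local Notation Q := (padic p_pr).
Local Notation abs := (@padic_abs p p_pr).
Local Notation r N := (p%:R ^- N : rat).

Let p0 : 0 < p%:R :> rat. Proof. by rewrite ltr0n prime_gt0. Qed.

Lemma padic_radius_gt0 N : 0 < r N. Proof. by rewrite invr_gt0 exprn_gt0. Qed.

Lemma padic_radius_le1 N : r N <= 1.
Proof. by rewrite invf_le1 ?exprn_gt0 // exprn_ege1 // ler1n prime_gt0. Qed.

Lemma padic_abs_int_le (N : nat) (k : int) :
  (abs k%:~R <= r N) = (p ^ N %| `|k|)%N.
Proof. by rewrite -ratr_int padic_abs_ratr rat_padic_norm_int_le. Qed.

Lemma padic_abs_nat_le (N : nat) (k : nat) : (abs k%:R <= r N) = (p ^ N %| k)%N.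
Proof. by rewrite -[k%:R]/(k%:~R) padic_abs_int_le. Qed.

Lemma padic_abs_nat_le1 (k : nat) : abs k%:R <= 1.
Proof. by have := padic_abs_nat_le 0 k; rewrite expr0 invr1 expn0 dvd1n. Qed.

Lemma padic_abs1 : abs 1 = 1.
Proof. by rewrite -[1]/(1%:~R) -ratr_int padic_abs_ratr rat_padic_norm1. Qed.

Lemma padic_nat_neq0 (k : nat) : (0 < k)%N -> k%:R != 0 :> Q.
Proof.
move=> k0; rewrite -padic_abs_eq0 -ratr_nat padic_abs_ratr rat_padic_norm_eq0 //.
by rewrite pnatr_eq0 -lt0n.
Qed.

Lemma padic_absV1 {y : Q} : abs y = 1 -> abs y^-1 = 1.
Proof.
move=> y1; rewrite -[LHS]mul1r -y1 -padic_absM divff ?padic_abs1 //.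
by rewrite -padic_abs_eq0 y1 oner_eq0.
Qed.

Lemma padic_abs_dist (x y : Q) : abs (x - y) = abs (y - x).
Proof. by rewrite -padic_absN opprB. Qed.

Lemma padic_abs_trans {y x z : Q} {e : rat} :
  abs (x - y) <= e -> abs (y - z) <= e -> abs (x - z) <= e.
Proof.
move=> xy yz; rewrite -[x - z](subrKA y) (le_trans (padic_absD _ _)) // ge_max.
by rewrite xy.
Qed.

Lemma padic_abs_near {x y : Q} {e : rat} :
  abs (x - y) <= e -> e <= 1 -> abs x <= 1 -> abs y <= 1.
Proof.
move=> xy e1 x1; rewrite -[y]subr0; apply: (@padic_abs_trans x); last by rewrite subr0.
by rewrite padic_abs_dist (le_trans xy).
Qed.

(** The class of this constant sequence is the image of q in Q_p, which makes
    |u - q| on Q_p a limit of norms of rational numbers. *)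
Definition cst_seq (q : rat) : padic_cauchy_seq p_pr :=
  insubd (0 : padic_cauchy_seq p_pr) (fun=> q).

Lemma cst_seqE q n : cst_seq q n = q.
Proof.
rewrite /cst_seq -[LHS]/(val (insubd _ _) n) insubdK //; apply/asboolP => e e0.
by exists 0%N => i j _ _; rewrite subrr rat_padic_norm0.
Qed.

Lemma pi_cst_seq q : \pi_Q (cst_seq q) = ratr q.
Proof.
have d0 : (denq q)%:~R != 0 :> Q.
  by rewrite -absz_denq; apply: padic_nat_neq0; rewrite absz_gt0 denq_neq0.
apply: (mulIf d0); rewrite divfK // -(rmorph_int \pi_Q) -(rmorph_int \pi_Q) -rmorphM.
congr (\pi _); apply: val_inj; apply/funext => n.
have seqE (k : int) : (k%:~R : nat -> rat) n = k%:~R.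
  have nat_seq (j : nat) : (j%:R : nat -> rat) n = j%:R.
    by elim: j => // j IH; rewrite !mulrS -IH.
  case: k => j; first exact: nat_seq.
  rewrite NegzE !mulrNz; congr (- _); exact: nat_seq.
rewrite rmorph_int seqE //.
rewrite -[LHS]/(cst_seq q n * (val (denq q)%:~R) n) rmorph_int seqE //.
by rewrite cst_seqE -numqE.
Qed.

(** A Cauchy sequence of rationals converges to its class. *)
Lemma padic_near_rat (x : Q) (N : nat) : exists q : rat, abs (x - ratr q) <= r N.
Proof.
rewrite -[x]reprK; set u := repr x.
have [n0 un] := padic_cauchy_seqP u (padic_radius_gt0 N); exists (u n0).
rewrite -pi_cst_seq -rmorphB.
apply: (cvgr_to_le (@padic_abs_cvg p p_pr (u - cst_seq (u n0)))).
exists n0 => // n /= n0n; apply/ltW.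
by rewrite -[X in rat_padic_norm p X]/(u n - cst_seq (u n0) n) cst_seqE un.
Qed.

(** The denominator d of q is prime to p, so if 1 + a d = 0 modulo p^N then
    q is congruent to - a (numq q) modulo p^N. *)
Lemma padic_integral_near_nat (q : rat) (N : nat) : rat_padic_norm p q <= 1 ->
  exists m : nat, (0 < m <= p ^ N)%N /\ abs (ratr q - m%:R) <= r N.
Proof.
move=> q1; have pN0 : (0 < p ^ N)%N by rewrite expn_gt0 prime_gt0.
have ndvd : ~~ (p %| `|denq q|)%N.
  apply/negP => pd.
  have q0 : q != 0.
    apply: contraTneq pd => ->; rewrite -[0]/(0%:~R) denq_int dvdn1 neq_ltn.
    by rewrite prime_gt1 ?orbT.
  have pn : ~~ (p %| `|numq q|)%N.
    by rewrite -prime_coprime // (coprime_dvdl pd) // coprime_sym coprime_num_den.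
  move: q1; rewrite /rat_padic_norm (negbTE q0) leNgt => /negP; apply.
  rewrite [logn p `|numq q|]lognE (negbTE pn) !andbF subr0.
  rewrite exprn_egt1 ?ltr1n ?prime_gt1 // -lt0n logn_gt0 mem_primes p_pr pd.
  by rewrite absz_gt0 denq_neq0.
have co : coprime (p ^ N) `|denq q| by rewrite coprimeXl // prime_coprime.
have [a _] := Bezoutl `|denq q| pN0; rewrite (eqP co) => dvd_a.
have P0 : (p ^ N)%:Z != 0 by rewrite eqz_nat -lt0n.
pose X := - a%:Z * numq q; pose m0 := (X %% (p ^ N)%:Z)%Z.
have m0_ge0 : 0 <= m0 by rewrite modz_ge0.
have m0_lt : m0 < (p ^ N)%:Z by rewrite ltz_pmod.
(* The residue 0 is represented by p^N, to keep m positive. *)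
pose m := if m0 == 0 then (p ^ N)%N else `|m0|%N.
have m_mod : ((p ^ N)%:Z %| X - m%:Z)%Z.
  rewrite /m; case: eqP => [X0|_].
    by rewrite rpredB // ?dvdzz //; apply/dvdz_mod0P.
  rewrite gez0_abs // /m0 {1}(divz_eq X (p ^ N)%:Z) addrK.
  exact: dvdz_mull.
exists m; split.
  by rewrite /m; case: eqP => [_|/eqP]; lia.
have d0 : (denq q)%:~R != 0 :> Q.
  by rewrite -absz_denq; apply: padic_nat_neq0; rewrite absz_gt0 denq_neq0.
have d1 : abs (denq q)%:~R = 1.
  have := @rat_padic_normE p p_pr (denq q) 1 (denq_neq0 q) isT.
  rewrite divr1 -padic_abs_ratr ratr_int => ->.
  by rewrite [logn p `|denq q|]lognE (negbTE ndvd) !andbF logn1.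
have -> : ratr q - m%:R = (numq q - m%:Z * denq q)%:~R / (denq q)%:~R :> Q.
  by rewrite /ratr rmorphB rmorphM /= mulrBl mulfK.
rewrite padic_absM (padic_absV1 d1) mulr1.
rewrite padic_abs_int_le.
have -> : numq q - m%:Z * denq q =
    (X - m%:Z) * denq q + numq q * (1 + a * `|denq q|)%N%:Z.
  by rewrite PoszD PoszM absz_denq /X; ring.
apply: (_ : ((p ^ N)%:Z %| _)%Z).
by apply: rpredD; [exact: dvdz_mulr|exact: dvdz_mull].
Qed.

Lemma padic_near_nat (x : Q) (N : nat) : abs x <= 1 ->
  exists m : nat, (0 < m <= p ^ N)%N /\ abs (x - m%:R) <= r N.
Proof.
move=> x1; have [q xq] := padic_near_rat x N.
have := padic_abs_near xq (padic_radius_le1 N) x1; rewrite padic_abs_ratr.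
move=> /padic_integral_near_nat-/(_ N)[m [mN qm]].
by exists m; split; [exact: mN|exact: padic_abs_trans xq qm].
Qed.

Definition pball (N : nat) (c : Q) : set Q := [set y | abs (y - c) <= r N].

Lemma open_pball N c : open (pball N c).
Proof.
rewrite openE => y /= yc; apply/nbhs_ballP; exists (r N); first exact: padic_radius_gt0.
move=> z; rewrite ballEmdist /= => yz.
by apply: padic_abs_trans yc; rewrite padic_abs_dist ltW.
Qed.

Lemma open_padic_integers : open (@padic_integers p p_pr).
Proof.
suff -> : @padic_integers p p_pr = pball 0 0 by exact: open_pball.
by apply/seteqP; split => y; rewrite /padic_integers /pball /= subr0 expr0 invr1.
Qed.

Lemma measurable_padic_open (A : set Q) :
  open A -> measurable (A : set (padic_borel p_pr)).
Proof. by move=> oA; exact: sub_sigma_algebra. Qed.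

Lemma measurable_pball N c : measurable (pball N c : set (padic_borel p_pr)).
Proof. exact: (measurable_padic_open _ (open_pball N c)). Qed.

Lemma measurable_padic_set1 (y : Q) : measurable ([set y] : set (padic_borel p_pr)).
Proof.
suff -> : [set y] = \bigcap_N pball N y.
  by apply: bigcapT_measurable => N; exact: measurable_pball.
apply/seteqP; split => [_ -> N _|z zy].
  by rewrite /pball /= subrr (eqP (_ : abs 0 == 0)) ?padic_abs_eq0 // ltW ?padic_radius_gt0.
apply/eqP; rewrite -subr_eq0 -padic_abs_eq0 eq_le padic_abs_ge0 andbT leNgt.
apply/negP => /(exists_exprVn_lt _ _ _ (prime_gt1 p_pr))[N].
by rewrite ltNge zy.
Qed.

(** * Sets near the fractions with given product |a| b *)

(** These sets are the building blocks of the p-adic approximation sets; the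
    fractions a / b outside Z_p contribute nothing to them. *)
Definition padic_near (m N : nat) : set Q := [set y | abs y <= 1 /\
  exists ab : int * nat, [/\ ab.1 != 0, (0 < ab.2)%N, (`|ab.1| * ab.2)%N = m
    & abs (y - ab.1%:~R / ab.2%:R) <= r N]].

Lemma open_padic_near m N : open (padic_near m N).
Proof.
suff -> : padic_near m N = @padic_integers p p_pr `&`
    \bigcup_(ab in [set ab : int * nat | [/\ ab.1 != 0, (0 < ab.2)%N
      & (`|ab.1| * ab.2)%N = m]]) pball N (ab.1%:~R / ab.2%:R).
  apply: openI; first exact: open_padic_integers.
  by apply: bigcup_open => ab _; exact: open_pball.
apply/seteqP; split => y.
  by move=> [y1 [ab [a0 b0 abm yab]]]; split => //; exists ab.
by move=> [y1 [ab [a0 b0 abm] yab]]; split => //; exists ab.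
Qed.

(** * Haar measure *)

Section Haar.
Context {R : realType} {mu : {measure set (padic_borel p_pr) -> \bar R}}.
Hypothesis haar : is_padic_haar mu.
Local Notation rR N := (p%:R ^- N : R).

(** Z_p contains the p^N disjoint translates i + p^N Z_p with 0 <= i < p^N. *)
Lemma haar_pball N c : (mu (pball N c) <= (rR N)%:E)%E.
Proof.
have mb c' : measurable (pball N c' : set (padic_borel p_pr)).
  exact: measurable_pball.
have muE c' : mu (pball N c') = mu (pball N 0).
  rewrite -((haar.1 c') _ (mb 0)); congr (mu _); apply/seteqP; split => y /=.
    by move=> yc; exists (y - c'); rewrite /pball /= ?subr0 // addrC subrK.
  by move=> [z]; rewrite /pball /= subr0 => zN <-; rewrite addrC addKr.
rewrite muE {c}; set b := mu (pball N 0).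
set F := fun i : 'I_(p ^ N) => pball N i%:R.
have mF i : measurable (F i : set (padic_borel p_pr)) by exact: mb.
have mUF : measurable (\big[setU/set0]_(i < p ^ N) F i : set (padic_borel p_pr)).
  exact: bigsetU_measurable.
have tF : trivIset setT F.
  apply/trivIsetP => i j _ _ ij; apply/seteqP; split => // y [yi yj].
  have : abs ((i%:Z - j%:Z)%:~R) <= r N.
    by rewrite rmorphB; apply: padic_abs_trans yj; rewrite padic_abs_dist.
  rewrite padic_abs_int_le => /dvdn_leq; have := ltn_ord i; have := ltn_ord j.
  by move: ij; rewrite -val_eqE /=; lia.
have : (mu (\big[setU/set0]_(i < p ^ N) F i) <= 1)%E.
  rewrite -haar.2; apply: le_measure; rewrite ?inE //.
    exact: (measurable_padic_open _ open_padic_integers).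
  rewrite -bigcup_seq => y [i _] yi; rewrite /padic_integers /=.
  apply: (padic_abs_near _ (padic_radius_le1 N) (padic_abs_nat_le1 i)).
  by rewrite padic_abs_dist.
rewrite measure_semi_additive_ord // (eq_bigr (fun=> (1 * b)%E)); last first.
  by move=> i _; rewrite mul1e; exact: muE.
rewrite -ge0_sume_distrl // sumEFin sumr_const card_ord natrX.
have pN0 : 0 < p%:R ^+ N :> R by rewrite exprn_gt0 // ltr0n prime_gt0.
by rewrite -lee_pdivlMl // mule1.
Qed.

Lemma haar_set1 (y : Q) : mu [set y] = 0%E.
Proof.
apply/eqP; rewrite eq_le measure_ge0 andbT; apply/lee_addgt0Pr => e e0.
have [N Ne] := exists_exprVn_lt R p e (prime_gt1 p_pr) e0; rewrite add0e.
apply: (@le_trans _ _ (mu (pball N y))); last first.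
  by apply: (le_trans (haar_pball N y)); rewrite lee_fin ltW.
apply: le_measure; rewrite ?inE //; first exact: measurable_padic_set1.
  exact: measurable_pball.
by move=> _ ->; rewrite /pball /= subrr (eqP (_ : abs 0 == 0)) ?padic_abs_eq0.
Qed.

Lemma haar_cover (A : set Q) (N : nat) (s : seq Q) :
  measurable (A : set (padic_borel p_pr)) ->
  (forall y, A y -> exists2 c, c \in s & pball N c y) ->
  (mu A <= ((size s)%:R * rR N)%:E)%E.
Proof.
move=> mA As; pose U := \big[setU/set0]_(c <- s) pball N c.
have mU : measurable (U : set (padic_borel p_pr)).
  by apply: bigsetU_measurable => c _; exact: measurable_pball.
have AU : A `<=` U by move=> y /As[c cs yc]; rewrite /U -bigcup_seq; exists c.
apply: (@le_trans _ _ (mu U)); first by apply: le_measure; rewrite ?inE.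
rewrite /U {As U AU mU}; elim: s => [|c s IH].
  by rewrite big_nil measure0 mul0r.
rewrite big_cons /= mulrSr mulrDl mul1r addrC EFinD.
have mV : measurable (\big[setU/set0]_(c <- s) pball N c : set (padic_borel p_pr)).
  by apply: bigsetU_measurable => c' _; exact: measurable_pball.
apply: (le_trans (measureU2 mu (measurable_pball N c) mV)).
by apply: leeD => //; exact: haar_pball.
Qed.

(** A fraction with |a| b = m is, up to sign and inversion, s / (m / s) with
    s = min (|a|, b), and s^2 <= m. So at most p^k values of s occur and the
    fractions number at most 4 p^k, each with a ball of measure at most
    p^(-2k). *)
Lemma haar_padic_near (m k : nat) : (m <= p ^ k.*2)%N ->
  (mu (padic_near m k.*2) <= (4%:R / p%:R ^+ k)%:E)%E.
Proof.
move=> mpk.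
pose centers (s : nat) : seq Q :=
  let t := s%:R / (m %/ s)%:R in [:: t; - t; t^-1; - t^-1].
have -> : 4%:R / p%:R ^+ k =
    (size (flatten [seq centers s | s <- iota 1 (p ^ k)]))%:R * rR k.*2.
  rewrite size_flatten /shape -map_comp /= (eq_map (_ : _ =1 fun=> 4%N)) //.
  have -> : forall s : seq nat, sumn [seq 4%N | _ <- s] = (4 * size s)%N.
    by elim=> //= _ s ->; rewrite mulnS.
  rewrite size_iota natrM natrX -addnn exprD invfM mulrA mulfK //.
  by rewrite expf_neq0 // pnatr_eq0 -lt0n prime_gt0.
apply: haar_cover.
  exact: (measurable_padic_open _ (open_padic_near m k.*2)).
move=> y [_ [[a b] [/= a0 b0 abm yab]]].
have a0' : (0 < `|a|)%N by rewrite absz_gt0.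
pose s := minn `|a| b.
have s_gt0 : (0 < s)%N by rewrite leq_min a0'.
have s_le : (s <= p ^ k)%N.
  rewrite -leq_sqr -expnM muln2 (leq_trans _ mpk) // -abm -mulnn.
  by rewrite leq_mul ?geq_minl ?geq_minr.
exists (a%:~R / b%:R); last exact: yab.
apply/flattenP; exists (centers s).
  by apply: map_f; rewrite mem_iota s_gt0 add1n ltnS.
have aE : a%:~R = (-1) ^+ (a < 0)%R * `|a|%N%:R :> Q.
  by rewrite {1}[a]intEsign rmorphM rmorph_sign.
rewrite aE /centers /s; case: (leqP `|a| b) => _; rewrite -abm.
  by rewrite mulKn //; case: (a < 0);
    rewrite ?expr1 ?expr0 ?mulN1r ?mul1r ?mulNr !inE eqxx ?orbT.
by rewrite mulnK // invf_div; case: (a < 0);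
  rewrite ?expr1 ?expr0 ?mulN1r ?mul1r ?mulNr !inE eqxx ?orbT.
Qed.

(** The index set consists of pairs (m, N), enumerated for the greedy choice.
    For any k, a point of Z_p lies in [padic_near m k.*2] for some m <= p^(2k),
    and these sets are small when k is large. *)
Lemma haar_subfamily (x : R) : 0 <= x <= 1 ->
  exists S : set (nat * nat), (forall t, S t -> (0 < t.1)%N) /\
    mu (\bigcup_(t in S) padic_near t.1 t.2) = x%:E.
Proof.
move=> /andP[x0 x1].
pose B n := let t := odflt (0%N, 0%N) (pickle_inv n) in padic_near t.1 t.2.
have mB n : measurable (B n : set (padic_borel p_pr)).
  exact: (measurable_padic_open _ (open_padic_near _ _)).
have mZ := measurable_padic_open _ (open_padic_integers).
have xZ : (x%:E <= mu (@padic_integers p p_pr))%E by rewrite haar.2 lee_fin.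
have small (e : R) : 0 < e -> @padic_integers p p_pr `<=`
    \bigcup_(t in [set t | (mu (B t) <= e%:E)%E]) B t.
  move=> e0 y y1; have e4 : 0 < e / 4%:R by rewrite divr_gt0.
  have [k ke] := exists_exprVn_lt R p _ (prime_gt1 p_pr) e4.
  have [m [/andP[m0 mk] ym]] := padic_near_nat y k.*2 y1.
  exists (pickle (m, k.*2)); rewrite /= /B pickleK_inv /=.
    apply: (le_trans (haar_padic_near _ _ mk)); rewrite lee_fin.
    by rewrite -ler_pdivlMl // mulrC ltW.
  split => //; exists (m%:Z, 1%N); split => //=; first by rewrite eqz_nat -lt0n.
    by rewrite muln1.
  by rewrite divr1.
have [S SE] := measure_subfamily_eq mu x _ B x0 mZ xZ mB small.
exists [set t | S (pickle t) /\ (0 < t.1)%N]; split; first by move=> t [].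
rewrite -SE; congr (mu _); apply/seteqP; split => y.
  by move=> [t [St t0] yt]; exists (pickle t) => //; rewrite /B pickleK_inv.
move=> [n Sn]; rewrite /B; case E : (pickle_inv _) => [t|] /=; last first.
  by move=> [_ [ab [a0 b0 /eqP]]]; rewrite muln_eq0 absz_eq0 (negbTE a0) gtn_eqF.
have tn : pickle t = n by have := @pickle_invK (nat * nat)%type n; rewrite E.
move=> yt; exists t => //; split; first by rewrite tn.
have [_ [ab [a0 b0 <- _]]] := yt.
by rewrite muln_gt0 absz_gt0 a0.
Qed.
End Haar.

(** * The p-adic approximation function *)

Section ApproximationFunction.
Context {R : realType}.
Local Notation rR N := (p%:R ^- N : R).
Variable T : set (nat * nat).

(** The pair (m, N) of T acts on n = m l, where l is the largest prime factor of
    n, when l is congruent to 1 modulo p^(N+1). The exponent N.+1 instead of N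
    ensures that l is prime to p even when N = 0. *)
Definition padic_level (n N : nat) : bool :=
  let l := max_pdiv n in
  [&& prime l, (p ^ N.+1 %| l.-1)%N & `[< T (n %/ l, N)%N >]].

(** For one n, several N may be possible; the least one gives the largest ball,
    which contains the others. *)
Definition padic_psi (n : nat) : R :=
  if pselect (exists N, padic_level n N) is left ex then n%:R * rR (ex_minn ex)
  else 0.

Lemma padic_psi_ge0 n : 0 <= padic_psi n.
Proof.
by rewrite /padic_psi; case: pselect.
Qed.

Lemma padic_psi_neq0 n : padic_psi n != 0 ->
  exists m l N : nat, [/\ prime l, (p ^ N.+1 %| l.-1)%N, T (m, N), n = (m * l)%N
    & padic_psi n = n%:R * rR N].
Proof.
rewrite /padic_psi; case: pselect => [ex|]; last by rewrite eqxx.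
move=> _; case: ex_minnP => N /and3P[l_pr pN /asboolP TN] _.
by exists (n %/ max_pdiv n)%N, (max_pdiv n), N; split; rewrite ?divnK ?max_pdiv_dvd.
Qed.

Lemma padic_psi_ge (m l N : nat) : prime l -> (0 < m < l)%N ->
  (p ^ N.+1 %| l.-1)%N -> T (m, N) ->
  rR N <= padic_psi (m * l) / (m * l)%:R.
Proof.
move=> l_pr ml pN TN.
have lev : padic_level (m * l) N.
  rewrite /padic_level max_pdivM_prime // l_pr pN mulnK ?prime_gt0 //.
  exact/asboolP.
rewrite /padic_psi; case: pselect => [ex|[]]; last by exists N.
have n0 : (m * l)%:R != 0 :> R.
  by case/andP: ml => m0 _; rewrite pnatr_eq0 -lt0n muln_gt0 m0 prime_gt0.
rewrite mulrAC divff // mul1r; case: ex_minnP => K _ /(_ _ lev) KN.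
have pR0 : 0 < p%:R :> R by rewrite ltr0n prime_gt0.
by rewrite lef_pV2 ?posrE ?exprn_gt0 // ler_weXn2l // ler1n prime_gt0.
Qed.

Local Notation absR := (fun y : Q => ratr (abs y) : R).

Lemma ler_ratr_radius (q : rat) N : ((ratr q : R) <= rR N) = (q <= r N).
Proof.
rewrite -(ler_rat R) rmorphV /= ?rmorphXn /= ?ratr_nat //.
by rewrite unitfE expf_neq0 // pnatr_eq0 gtn_eqF ?prime_gt0.
Qed.

Lemma padic_unit_of_dvd {l N : nat} : (0 < l)%N -> (p ^ N.+1 %| l.-1)%N ->
  abs l%:R = 1 /\ abs (l%:R - 1) <= r N.
Proof.
move=> l0 pl.
have lE : l%:R - 1 = l.-1%:R :> Q by rewrite -[in LHS](prednK l0) mulrSr addrK.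
have leN : abs (l%:R - 1) <= r N.+1 by rewrite lE padic_abs_nat_le.
have r1 : r N.+1 < 1.
  by rewrite invf_lt1 ?exprn_gt0 ?exprn_egt1 ?ltr1n ?ltr0n ?prime_gt0 ?prime_gt1.
split; last first.
  apply: (le_trans leN); rewrite lef_pV2 ?posrE ?exprn_gt0 ?ltr0n ?prime_gt0 //.
  by rewrite ler_weXn2l // ler1n prime_gt0.
apply/eqP; rewrite eq_le padic_abs_nat_le1 /= leNgt; apply/negP => l1.
have := padic_absD (l%:R : Q) (- (l%:R - 1)).
rewrite opprB addrC subrK padic_abs1 padic_abs_dist leNgt gt_max l1.
by rewrite (le_lt_trans leN r1).
Qed.

Lemma padic_absM_near {u y : Q} {e : rat} : abs (u - 1) <= e -> abs y <= 1 ->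
  abs (y * u - y) <= e.
Proof.
move=> u1 y1; rewrite -{2}[y]mulr1 -mulrBr padic_absM.
by apply: le_trans u1; rewrite ler_piMl // padic_abs_ge0.
Qed.

(** Reduce the fraction a / b near y to a' / b' and multiply the numerator by a
    prime l congruent to 1 modulo p^(N+1): since |a' / b'| <= 1, this moves the
    fraction by at most p^-N, and it remains reduced if l is large. *)
Lemma padic_frakA_lower (m N : nat) :
  (forall m' g, m = (m' * g ^ 2)%N -> T (m', N)) ->
  padic_near m N `<=` frakA absR (@padic_integers p p_pr) padic_psi.
Proof.
move=> Tm y [y1 [[a b] [/= a0 b0 abm yab]]]; split => //.
have [g [b' [a' [g0 aE bE co]]]] := reduce_fraction _ _ a0 b0.
have [a0' b0'] : a' != 0 /\ (0 < b')%N.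
  split; first by apply: contraNneq a0 => a0'; rewrite aE a0' mul0r.
  by move: b0; rewrite bE muln_gt0 => /andP[].
have abE : a%:~R / b%:R = a'%:~R / b'%:R :> Q.
  rewrite aE bE rmorphM natrM /= -mulf_div divff ?mulr1 //.
  exact: padic_nat_neq0.
rewrite abE {abE} in yab.
have Tm' : T (`|a'| * b', N)%N.
  by apply: (Tm _ g); rewrite -abm aE bE abszM /=; ring.
have m'0 : (0 < `|a'| * b')%N by rewrite muln_gt0 absz_gt0 a0'.
apply: infinite_pairs => M.
have [l [l_pr Ml pl]] := prime_eq1_mod p N.+1 (maxn M (`|a'| * b')) p_pr.
move: Ml; rewrite gtn_max => /andP[Ml m'l].
have l0 := prime_gt0 l_pr.
have nE : (`|(a' * l%:Z)%R| * b' = `|a'| * b' * l)%N by rewrite abszM /= mulnAC.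
exists (a' * l%:Z, b') => /=; last by rewrite nE (leq_trans Ml) // leq_pmull.
split => //=.
- by rewrite mulf_neq0 // eqz_nat -lt0n.
- rewrite abszM coprimeMl co /= prime_coprime //.
  by rewrite gtnNdvd // (leq_ltn_trans _ m'l) // leq_pmull // absz_gt0.
have ml : (0 < `|a'| * b' < l)%N by rewrite m'0.
rewrite /psi_close nE; apply: le_trans (padic_psi_ge _ _ _ l_pr ml pl Tm').
rewrite ler_ratr_radius rmorphM mulrAC; apply: (padic_abs_trans yab).
have [_ lN] := padic_unit_of_dvd l0 pl.
rewrite padic_abs_dist; apply: padic_absM_near => //.
exact: padic_abs_near yab (padic_radius_le1 N) y1.
Qed.

(** If |a| b = m l, then removing l from the numerator or the denominator moves
    a / b, which lies in Z_p when it is close to a point of Z_p, by at most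
    p^-N. *)
Lemma padic_frakK_upper :
  frakK absR (@padic_integers p p_pr) padic_psi `<=`
    (\bigcup_(t in T) padic_near t.1 t.2) `|` fractions Q.
Proof.
move=> y [y1 /infinite_setN0[[a b] [/= a0 b0]]]; rewrite /psi_close.
have n0 : (0 < `|a| * b)%N by rewrite muln_gt0 absz_gt0 a0.
have [->|/padic_psi_neq0[m [l [N [l_pr pl Tm nE ->]]]]] :=
    eqVneq (padic_psi (`|a| * b)) 0.
  rewrite mul0r -[X in _ <= X](rmorph0 (@ratr R)) ler_rat => yab; right.
  exists (a, b) => //; apply/eqP; rewrite eq_sym -subr_eq0 -padic_abs_eq0.
  by rewrite eq_le yab padic_abs_ge0.
rewrite mulrAC divff ?pnatr_eq0 -?lt0n // mul1r ler_ratr_radius => yab; left.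
exists (m, N) => //; split => //=.
have l0 := prime_gt0 l_pr.
have [l1 lN] := padic_unit_of_dvd l0 pl.
have ab1 := padic_abs_near yab (padic_radius_le1 N) y1.
have : (l %| `|a| * b)%N by rewrite nE dvdn_mull.
rewrite Euclid_dvdM // => /orP[la|/dvdnP[c bE]].
  have /dvdzP[c aE] : (l%:Z %| a)%Z by rewrite dvdzE.
  have abE : a%:~R / b%:R = (c%:~R / b%:R) * l%:R :> Q.
    by rewrite aE rmorphM /= mulrAC.
  exists (c, b); split; [|exact: b0| |] => /=.
  - by apply: contraNneq a0 => c0; rewrite aE c0 mul0r.
  - by apply/eqP; rewrite -(eqn_pmul2r l0) -nE aE abszM mulnAC.
  apply: (padic_abs_trans yab); rewrite abE; apply: (padic_absM_near lN).
  by move: ab1; rewrite abE padic_absM l1 mulr1.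
have abE : a%:~R / c%:R = (a%:~R / b%:R) * l%:R :> Q.
  by rewrite bE natrM invfM mulrA -mulrA mulVf ?mulr1 // padic_nat_neq0.
exists (a, c); split; [exact: a0| | |] => /=.
- by move: b0; rewrite bE muln_gt0 => /andP[].
- by apply/eqP; rewrite -(eqn_pmul2r l0) -nE bE mulnA.
apply: (padic_abs_trans yab); rewrite abE padic_abs_dist.
exact: (padic_absM_near lN ab1).
Qed.
End ApproximationFunction.
End Padic.

Lemma padic_case {R : realType} (x : R) {p : nat} {p_pr : prime p}
    (mu : {measure set (padic_borel p_pr) -> \bar R}) :
  0 <= x <= 1 -> is_padic_haar mu ->
  exists psi : nat -> R, (forall n, (0 < n)%N -> 0 <= psi n) /\
    mu (frakA (fun y => ratr (padic_abs y)) (@padic_integers p p_pr) psi) = x%:E /\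
    mu (frakK (fun y => ratr (padic_abs y)) (@padic_integers p p_pr) psi) = x%:E.
Proof.
move=> x01 haar; have [S [S0 SE]] := haar_subfamily haar x x01.
(* Closing S under division of m by squares provides for reduced fractions. *)
pose T := [set t : nat * nat | exists g : nat, S (t.1 * g ^ 2, t.2)%N].
exists (padic_psi (p := p) T); split; first by move=> n _; exact: padic_psi_ge0.
set A := frakA _ _ _; set K := frakK _ _ _.
set U := \bigcup_(t in S) padic_near t.1 t.2 in SE.
have AK : A `<=` K by exact: frakA_sub_frakK.
have UA : U `<=` A.
  move=> y [[m N] St]; apply: padic_frakA_lower => m' g mE.
  by exists g; rewrite /= -mE.
have KU : K `<=` U `|` fractions (padic p_pr).
  move=> y /padic_frakK_upper[|]; last by right.
  move=> [[m N] [g Sg] [y1 [[a b] [/= a0 b0 abm yab]]]]; left.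
  have g0 : (0 < g)%N.
    by have := S0 _ Sg; rewrite /= muln_gt0 expn_gt0 orbF => /andP[].
  exists (m * g ^ 2, N)%N => //; split => //; exists (a * g%:Z, (b * g)%N); split => /=.
  - by rewrite mulf_neq0 // eqz_nat -lt0n.
  - by rewrite muln_gt0 b0.
  - by rewrite abszM -abm /=; ring.
  by rewrite rmorphM natrM /= -mulf_div divff ?mulr1 // padic_nat_neq0.
have mU : measurable (U : set (padic_borel p_pr)).
  apply: measurable_padic_open; apply: bigcup_open => t _.
  exact: open_padic_near.
have m1 (y : padic p_pr) := measurable_padic_set1 y.
have cC := countable_fractions (padic p_pr).
split; rewrite -SE.
  exact: (measure_between_countable mu mU UA (subset_trans AK KU) m1 (haar_set1 haar) cC).
exact: (measure_between_countable mu mU (subset_trans UA AK) KU m1 (haar_set1 haar) cC).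
Qed.

Theorem theorem2p2 (R : realType) (x : R) (x01 : 0 <= x <= 1) :
  (forall (p : nat) (p_pr : prime p)
      (mu : {measure set (padic_borel p_pr) -> \bar R}), is_padic_haar mu ->
    exists psi : nat -> R, (forall n, (0 < n)%N -> 0 <= psi n) /\
      mu (frakA (fun y => ratr (padic_abs y)) (@padic_integers p p_pr) psi)
        = x%:E /\
      mu (frakK (fun y => ratr (padic_abs y)) (@padic_integers p p_pr) psi)
        = x%:E) /\
  (exists psi : nat -> R, (forall n, (0 < n)%N -> 0 <= psi n) /\
      lebesgue_measure (frakA (fun y : R => `|y|) `[0, 1] psi) = x%:E /\
      lebesgue_measure (frakK (fun y : R => `|y|) `[0, 1] psi) = x%:E).
Proof.
by split => [p p_pr mu haar|]; [exact: padic_case|exact: real_case].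
Qed.
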